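(* Let $(X,d)$ be a metric space and let $\mathscr{B}$ be a bornology on $X$ with a closed base $\mathscr{S}$. The following statements are equivalent. (1) The space $(C(X),\mathscr{T}_{\mathscr{B}}^s)$ is almost complete. (2) The space $(C(X),\mathscr{T}_{\mathscr{B}}^s)$ is pseudo-complete and a $\sigma$-space. (3) The space $(C(X),\mathscr{T}_{\mathscr{B}}^s)$ is a pseudo-complete space with at least one $q_D$-point for some dense subset $D\subseteq C(X)$.
   Context: A bornology $\mathscr{B}$ on a nonempty set $X$ is a family of nonempty subsets of $X$ that covers $X$ and is closed under taking finite unions and under taking (nonempty) subsets. A subfamily $\mathscr{S}\subseteq\mathscr{B}$ is a base of $\mathscr{B}$ if each $B\in\mathscr{B}$ is contained in some $A\in\mathscr{S}$; it is a closed base if moreover every member of $\mathscr{S}$ is a closed subset of $X$. $C(X)$ is the set of continuous functions from $X$ to $\mathbb{R}$. For $\delta>0$ and $B\subseteq X$, $B^\delta=\bigcup_{b\in B}\{x\in X:d(x,b)<\delta\}$. The topology $\mathscr{T}_{\mathscr{B}}^s$ of strong uniform convergence on $\mathscr{B}$ is the topology on $C(X)$ induced by the uniformity having as a base of entourages all sets $[B;\varepsilon]^s=\{(f,g)\in C(X)\times C(X): \text{there is } \delta>0 \text{ such that } |f(x)-g(x)|<\varepsilon \text{ for all } x\in B^\delta\}$, where $B\in\mathscr{B}$ and $\varepsilon>0$. Let $T$ be a topological space. A family of subsets of $T$ is an almost cover if its union is dense in $T$. An almost sieve $\langle\{U_i:i\in I_n\},\pi_n:n\ge1\rangle$ on $T$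 is a sequence of indexed almost covers $\{U_i:i\in I_n\}$ of $T$ together with maps $\pi_n:I_{n+1}\to I_n$ such that for all $n\ge1$ and $i\in I_n$, $\bigcup\{U_j:j\in\pi_n^{-1}(i)\}$ is a dense subset of $U_i$. It is open if all $U_i$ are open. A $\pi$-chain is a sequence $\langle i_n:n\ge1\rangle$ with $i_n\in I_n$ and $\pi_n(i_{n+1})=i_n$ for all $n\ge1$. A filterbase $\mathscr{F}$ on $T$ is controlled by a sequence $\langle U_n:n\ge1\rangle$ of subsets if each $U_n$ contains some $F\in\mathscr{F}$. A sequence $\langle U_n:n\ge1\rangle$ is complete if each filterbase controlled by it clusters, i.e. has a cluster point in $T$ (a point in $\bigcap_{F\in\mathscr{F}}\overline{F}$). $T$ is almost complete if there is an open almost sieve on $T$ such that $\langle U_{i_n}:n\ge1\rangle$ is a complete sequence for each $\pi$-chain $\langle i_n:n\ge1\rangle$. $T$ is pseudo-complete if it has a sequence $\langle\mathscr{B}_n:n\ge1\rangle$ of $\pi$-bases (families of nonempty open sets such that every nonempty open set contains a member) such that $\bigcap_{n\ge1}V_n\neq\emptyset$ whenever $\overline{V_{n+1}}\subseteq V_n\in\mathscr{B}_n$ for each $n\ge1$. $T$ is a $\sigma$-space if it has a $\sigma$-discrete network. Let $D$ be a dense subset of $T$. A point $x\in T$ is a $q_D$-point of $T$ if there is a sequence $\langle U_n:n\ge1\rangle$ of open neighborhoods of $x$ such that every sequence $\langle x_n:n\ge1\rangle$ with $x_n\in U_n\cap D$ for all $n\ge1$ has a cluster point in $T$. In (3), density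 is with respect to $\mathscr{T}_{\mathscr{B}}^s$. *)

(* Defs.v *)
From HB Require Import structures.
From mathcomp Require Import all_boot all_order all_algebra.
From mathcomp Require Import all_classical all_reals all_analysis.

Set Implicit Arguments.
Unset Strict Implicit.
Unset Printing Implicit Defensive.

Import Order.TTheory GRing.Theory Num.Theory.
Import numFieldNormedType.Exports.

Local Open Scope classical_set_scope.
Local Open Scope ring_scope.

Record bornology (X : Type) := Bornology {
  bornology_set : set (set X) ;
  bornology_carrier_neq0 : [set: X] !=set0 ;
  bornology_neq0 : forall A, bornology_set A -> A !=set0 ;
  bornology_cover : \bigcup_(A in bornology_set) A = [set: X] ;
  bornologyU : forall A B,
    bornology_set A -> bornology_set B -> bornology_set (A `|` B) ;
  bornologyS : forall A B,
    bornology_set A -> B `<=` A -> B !=set0 -> bornology_set B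
}.

Definition bornology_base (X : Type) (B : bornology X) (S : set (set X)) :=
  S `<=` bornology_set B /\
  forall A, bornology_set B A -> exists2 A', S A' & A `<=` A'.

Definition closed_base (X : topologicalType) (B : bornology X)
    (S : set (set X)) :=
  bornology_base B S /\ forall A, S A -> closed A.

Definition enlargement (R : realType) (X : metricType R) (A : set X) (d : R)
  : set X := \bigcup_(a in A) [set x | mdist x a < d].

Definition strong_entourage (R : realType) (X : metricType R) (A : set X)
    (e : R) : set (continuousType X R * continuousType X R) :=
  [set fg : continuousType X R * continuousType X R |
     exists2 d : R, 0 < d &
     forall x, enlargement A d x -> `|fg.1 x - fg.2 x| < e].

(* C(X) with the uniformity of strong uniform convergence on B; the alias
   lets the topology depend on B and keeps it apart from the library's
   topologies on continuousType. *)
Definition strongC (R : realType) (X : metricType R) (B : bornology X) : Type :=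
  continuousType X R.

Section strong_uniformity.
Context (R : realType) (X : metricType R) (B : bornology X).
Local Notation T := (strongC B).
Local Open Scope relation_scope.

HB.instance Definition _ := Choice.copy T (continuousType X R).

Definition strong_uniformity : set_system (T * T) :=
  filter_from [set p : set X * R | bornology_set B p.1 /\ 0 < p.2]
    (fun p => @strong_entourage R X p.1 p.2).

Let enlargementSr (A : set X) (d d' : R) :
  d <= d' -> enlargement A d `<=` enlargement A d'.
Proof. by move=> dd' x [a Aa /= ad]; exists a => //=; exact: lt_le_trans dd'. Qed.

Let strong_uniformity_filter : Filter strong_uniformity.
Proof.
apply: filter_from_filter.
  have [x _] := bornology_carrier_neq0 B.
  have : [set: X] x by [].
  by rewrite -(bornology_cover B) => -[A BA _]; exists (A, 1).
move=> [A e] [A' e'] [/= BA e0] [/= BA' e'0].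
exists (A `|` A', Num.min e e').
  by split=> /=; [exact: bornologyU|rewrite lt_min e0].
move=> [f g] [/= d d0 fg].
split; exists d => // x [a Aa ax].
- have /fg : enlargement (A `|` A') d x by exists a => //; left.
  by rewrite lt_min => /andP[].
- have /fg : enlargement (A `|` A') d x by exists a => //; right.
  by rewrite lt_min => /andP[].
Qed.

Let strong_uniformity_diagonal A : strong_uniformity A -> diagonal `<=` A.
Proof.
move=> [[E e] [/= BE e0] EA] [f g] /= /diagonalP <-.
by apply: EA; exists 1 => //= x _; rewrite subrr normr0.
Qed.

Let strong_uniformity_inv A : strong_uniformity A -> strong_uniformity A^-1.
Proof.
move=> [[E e] [/= BE e0] EA]; exists (E, e) => // -[f g] [/= d d0 fg].
by apply: EA; exists d => //= x /fg; rewrite distrC.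
Qed.

Let strong_uniformity_split A : strong_uniformity A ->
  exists2 A', strong_uniformity A' & A' \; A' `<=` A.
Proof.
move=> [[E e] [/= BE e0] EA].
exists (@strong_entourage R X E (e / 2)).
  by exists (E, e / 2) => //; split=> //=; rewrite divr_gt0.
move=> [f g] [h [/= d d0 fh] [/= d' d'0 hg]]; apply: EA.
exists (Num.min d d') => /=; first by rewrite lt_min d0.
move=> x Ex; rewrite -(subrKA (h x)) (splitr e).
rewrite (le_lt_trans (ler_normD _ _))// ltrD//.
- by apply/fh/(enlargementSr _ Ex); rewrite ge_min lexx.
- by apply/hg/(enlargementSr _ Ex); rewrite ge_min lexx orbT.
Qed.

HB.instance Definition _ := isUniform.Build T strong_uniformity_filter
  strong_uniformity_diagonal strong_uniformity_inv strong_uniformity_split.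

End strong_uniformity.

Section topological_notions.
Context (T : topologicalType).

Definition almost_cover (I : Type) (U : I -> set T) :=
  dense (\bigcup_(i in [set: I]) U i).

Definition dense_subset (A B : set T) := A `<=` B /\ B `<=` closure A.

(* Sequences are indexed by n >= 0 instead of n >= 1 throughout. *)
Record almost_sieve := AlmostSieve {
  sieve_index : nat -> Type ;
  sieve_set : forall n, sieve_index n -> set T ;
  sieve_proj : forall n, sieve_index n.+1 -> sieve_index n ;
  sieve_almost_cover : forall n, almost_cover (@sieve_set n) ;
  sieve_dense : forall n (i : sieve_index n),
    dense_subset (\bigcup_(j in @sieve_proj n @^-1` [set i]) sieve_set j)
                 (sieve_set i)
}.

Definition open_sieve (s : almost_sieve) :=
  forall n (i : sieve_index s n), open (sieve_set i).

Definition pi_chain (s : almost_sieve) (i : forall n, sieve_index s n) :=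
  forall n, sieve_proj (i n.+1) = i n.

Definition filterbase (F : set_system T) :=
  [/\ F !=set0, forall A, F A -> A !=set0 &
      forall A B, F A -> F B -> exists2 C, F C & C `<=` A `&` B].

Definition controlled (F : set_system T) (U : nat -> set T) :=
  forall n, exists2 A, F A & A `<=` U n.

Definition complete_sequence (U : nat -> set T) :=
  forall F, filterbase F -> controlled F U -> cluster F !=set0.

Definition almost_complete :=
  exists2 s : almost_sieve, open_sieve s &
    forall i : forall n, sieve_index s n,
      pi_chain i -> complete_sequence (fun n => sieve_set (i n)).

Definition pi_base (P : set (set T)) :=
  (forall V, P V -> open V /\ V !=set0) /\
  forall O, open O -> O !=set0 -> exists2 V, P V & V `<=` O.

Definition pseudo_complete :=
  exists2 P : nat -> set (set T), (forall n, pi_base (P n)) &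
    forall V : nat -> set T,
      (forall n, P n (V n) /\ closure (V n.+1) `<=` V n) ->
      \bigcap_n V n !=set0.

Definition network (N : set (set T)) :=
  forall x O, open_nbhs x O -> exists A, [/\ N A, A x & A `<=` O].

Definition discrete_family (N : set (set T)) :=
  forall x, exists2 O, open_nbhs x O & forall A B, N A -> N B ->
    A `&` O !=set0 -> B `&` O !=set0 -> A = B.

Definition sigma_discrete (N : set (set T)) :=
  exists2 D : nat -> set (set T),
    (forall n, discrete_family (D n)) & N = \bigcup_n D n.

Definition sigma_space := exists2 N, network N & sigma_discrete N.

Definition q_point (D : set T) (x : T) :=
  exists2 U : nat -> set T, (forall n, open_nbhs x (U n)) &
    forall u : nat -> T, (forall n, (U n `&` D) (u n)) ->
      cluster (u @ \oo) !=set0.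

End topological_notions.

(* Main.v *)
(* The three conditions meet in metrizability.  A q_D-point f yields an
   increasing sequence A_n in the bornology such that every member lies in the
   closure of some A_n: otherwise a bump added to f at a point x_n outside the
   closure of A_n gives functions g_n close to f on A_n with g_n(x_n) - f(x_n)
   large, and these have no cluster point.  Hence the uniformity has a countable
   base.  Given this, the space is a sigma-space, and pseudo-completeness gives
   an almost sieve made of nested finite sequences of ever smaller members of the
   pi-bases.  Conversely an almost sieve gives pi-bases witnessing
   pseudo-completeness as well as a q-point, once its indices are well-ordered so
   that a nested sequence of sets determines a single pi-chain.  Finally, in a
   Baire sigma-space some point avoids the boundaries of all closures of members
   of the network; it has a countable neighbourhood base and is a q-point. *)
Require Import Defs.
From mathcomp Require Import all_boot all_order all_algebra.
From mathcomp Require Import all_classical all_reals all_analysis.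
From mathcomp Require Import lra.

Set Implicit Arguments.
Unset Strict Implicit.
Unset Printing Implicit Defensive.

Import Order.TTheory GRing.Theory Num.Theory.
Import numFieldNormedType.Exports.

Local Open Scope classical_set_scope.
Local Open Scope ring_scope.

(** * Well-orderings and choice of dependent functions *)

Lemma well_orderingP (I : Type) : exists le : I -> I -> Prop,
  (forall x y, le x y -> le y x -> x = y) /\
  forall A : set I, A !=set0 -> exists2 z, A z & forall y, A y -> le z y.
Proof.
have [le lewo] := wochoice.well_ordering_principle {classic I}.
exists (fun x y => le x y).
have le_min (A : set I) : A !=set0 -> exists2 z, A z & forall y, A y -> le z y.
  move=> [a Aa]; pose A' : {pred {classic I}} := fun x => `[< A x >].
  have [|z [[/asboolP Az zmin] _]] := lewo A'; first by exists a; apply/asboolP.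
  by exists z => // y Ay; apply: zmin; apply/asboolP.
split=> // x y xy yx.
(* Antisymmetry: [x] and [y] are both least in the pair {x, y}, whose least element is unique. *)
pose A' : {pred {classic I}} := fun z => `[< z = x \/ z = y >].
have [|z [_ zu]] := lewo A'; first by exists x; apply/asboolP; left.
have lexx t : le t t.
  by have [|? -> ->] := le_min [set t]; first by exists t.
rewrite -(zu x); last first.
  split; first by apply/asboolP; left.
  by move=> t /asboolP[->|->].
apply: zu; split; first by apply/asboolP; right.
by move=> t /asboolP[->|->].
Qed.

Lemma dependent_fun_choice (I : Type) (T : I -> Type)
    (P : forall i, T i -> Prop) :
  (forall i, exists x, P i x) -> exists f : forall i, T i, forall i, P i (f i).
Proof. by move=> Pex; exists (fun i => sval (cid (Pex i))) => i; case: cid. Qed.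

(** * Nested sequences from pi-bases in a regular space *)

Section regular.
Context (T : topologicalType).
Hypothesis regT : @regular_space T.

Lemma regular_open_nbhs (x : T) (O : set T) : open_nbhs x O ->
  exists2 W, open_nbhs x W & closure W `<=` O.
Proof.
move=> /open_nbhs_nbhs /regT[A xA AO]; exists A°.
  by split; [exact: open_interior|exact: nbhs_singleton (nbhs_interior xA)].
by apply: subset_trans AO; apply: closureS; exact: interior_subset.
Qed.

Lemma pi_base_closure (P : set (set T)) (O : set T) : pi_base P ->
  open O -> O !=set0 -> exists2 V, P V & closure V `<=` O.
Proof.
move=> [_ Pb] oO [x Ox].
have [W [oW Wx] WO] : exists2 W, open_nbhs x W & closure W `<=` O.
  exact: regular_open_nbhs.
have [|V PV VW] := Pb _ oW; first by exists x.
by exists V => //; apply: subset_trans WO; exact: closureS.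
Qed.

(** The Baire category construction: by regularity, each new member can have its closure inside the
    previous member cut with the next [G n]. With [G] constantly [setT] it just provides a nested
    sequence. *)
Lemma pi_base_nested (P : nat -> set (set T)) (G : nat -> set T) :
  [set: T] !=set0 -> (forall n, pi_base (P n)) ->
  (forall n, open (G n) /\ dense (G n)) ->
  exists V, (forall n, P n (V n) /\ closure (V n.+1) `<=` V n) /\
            forall n, V n `<=` G n.
Proof.
move=> T0 Pb oG.
pose next n (V : set T) :=
  xget set0 [set W | P n.+1 W /\ closure W `<=` V `&` G n.+1].
pose V := fix V n := if n is m.+1 then next m (V m) else
  xget set0 [set W | P 0%N W /\ closure W `<=` G 0%N].
have V0 : P 0%N (V 0%N) /\ closure (V 0%N) `<=` G 0%N.
  apply: (@xgetPex _ set0 [set W | P 0%N W /\ closure W `<=` G 0%N]).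
  have [oG0 dG0] := oG 0%N; have [|W PW WG] := pi_base_closure (Pb 0%N) oG0.
    by have [x [_ Gx]] := dG0 _ T0 openT; exists x.
  by exists W.
have VS n : P n (V n) ->
    P n.+1 (V n.+1) /\ closure (V n.+1) `<=` V n `&` G n.+1.
  move=> PV; rewrite /=; apply: (@xgetPex _ set0
    [set W | P n.+1 W /\ closure W `<=` V n `&` G n.+1]).
  have [oV Vne] := (Pb n).1 _ PV; have [oGn dGn] := oG n.+1.
  have [||W PW WVG] := pi_base_closure (Pb n.+1) (O := V n `&` G n.+1).
  - exact: openI.
  - exact: dGn.
  - by exists W.
have PV n : P n (V n) by elim: n => [|n /VS[]//]; exact: V0.1.
exists V; split=> [n|[|n]].
- by split=> // x /(VS n (PV n)).2[].
- by apply: subset_trans V0.2; exact: subset_closure.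
- move=> x Vx; have /(VS n (PV n)).2[//] : closure (V n.+1) x.
  exact: subset_closure.
Qed.

Lemma pseudo_complete_baire (G : nat -> set T) :
  [set: T] !=set0 -> pseudo_complete T ->
  (forall n, open (G n) /\ dense (G n)) -> \bigcap_n G n !=set0.
Proof.
move=> T0 [P Pb PP] /(pi_base_nested T0 Pb)[V [/PP[x Vx] VG]].
by exists x => n _; apply: VG; exact: Vx.
Qed.

End regular.

(** * From almost sieves to pi-bases and q-points *)

Section sieve.
Context (T : topologicalType).

Lemma nested_subset (V : nat -> set T) :
  (forall n, closure (V n.+1) `<=` V n) ->
  forall m n, (m <= n)%N -> V n `<=` V m.
Proof.
move=> VS m n /subnK <-; elim: (n - m)%N => [//|k IH]; rewrite addSn.
by apply: subset_trans IH => x Vx; apply: VS; exact: subset_closure.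
Qed.

(** The range of [V] is a filterbase controlled by [V]; its cluster points lie in every
    [closure (V n.+1)], hence in every [V n]. *)
Lemma complete_sequence_bigcap (V : nat -> set T) :
  (forall n, V n !=set0) -> (forall n, closure (V n.+1) `<=` V n) ->
  complete_sequence V -> \bigcap_n V n !=set0.
Proof.
move=> V0 VS; have Vm := nested_subset VS.
move=> /(_ (range V))[||x clx].
- split; first by exists (V 0%N), 0%N.
  + by move=> _ [n _ <-].
  + move=> _ _ [n _ <-] [m _ <-]; exists (V (maxn n m)).
      by exists (maxn n m).
    by move=> x Vx; split; apply: Vm Vx; rewrite ?leq_maxl ?leq_maxr.
- by move=> n; exists (V n) => //; exists n.
- exists x => n _; apply: VS.
  by move: clx; rewrite clusterE; apply; exists n.+1.
Qed.

Lemma complete_sequence_q_point (V : nat -> set T) (x : T) :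
  (forall n, open_nbhs x (V n)) -> (forall m n, (m <= n)%N -> V n `<=` V m) ->
  complete_sequence V -> q_point [set: T] x.
Proof.
move=> xV Vm cV; exists V => // u uV; apply: cV.
  split; first by exists setT; exact: filterT.
  - by move=> A /filter_ex.
  - by move=> A B uA uB; exists (A `&` B) => //; exact: filterI.
move=> n; exists (V n) => //.
by exists n => // k /= nk; apply: Vm nk _ _; case: (uV k).
Qed.

Lemma complete_sequenceS (U V : nat -> set T) :
  (forall n, V n `<=` U n) -> complete_sequence U -> complete_sequence V.
Proof.
move=> VU cU F fF cF; apply: cU => // n.
by have [A FA AV] := cF n; exists A => //; apply: subset_trans (VU n).
Qed.

(* [lex_least n V i] means that, level by level, the chain of [i] down to level
   0 picks the least index whose set meets [V].  Shrinking [V] inside its own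
   [sieve_set i] does not change this index, so that a nested sequence of such
   [V]s selects a pi-chain. *)
Fixpoint lex_least (s : almost_sieve T) (le : forall n, sieve_index s n ->
    sieve_index s n -> Prop) (n : nat) (V : set T) :
    sieve_index s n -> Prop :=
  match n return sieve_index s n -> Prop with
  | 0%N => fun i => (sieve_set i `&` V !=set0) /\
      forall j, sieve_set j `&` V !=set0 -> le 0%N i j
  | m.+1 => fun i => lex_least le V (sieve_proj i) /\
      (sieve_set i `&` V !=set0) /\
      forall j, sieve_proj j = sieve_proj i ->
        sieve_set j `&` V !=set0 -> le m.+1 i j
  end.

Section lex_least.
Context (s : almost_sieve T).
Variable le : forall n, sieve_index s n -> sieve_index s n -> Prop.
Hypothesis le_anti : forall n (i j : sieve_index s n),
  le i j -> le j i -> i = j.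
Hypothesis le_min : forall n (A : set (sieve_index s n)), A !=set0 ->
  exists2 i, A i & forall j, A j -> le i j.

Lemma sieve_setS n (i : sieve_index s n.+1) :
  sieve_set i `<=` sieve_set (sieve_proj i).
Proof.
move=> x ix; have [+ _] := sieve_dense (sieve_proj i); apply.
by exists i.
Qed.

Lemma lex_least_inj n (V : set T) (i j : sieve_index s n) :
  lex_least le V i -> lex_least le V j -> i = j.
Proof.
elim: n i j => [|n IH] i j /=.
  by move=> [iV imin] [jV jmin]; apply: le_anti; [exact: imin|exact: jmin].
move=> [si [iV imin]] [sj [jV jmin]]; have ij := IH _ _ si sj.
by apply: le_anti; [exact: imin|exact: jmin].
Qed.

Lemma lex_leastS n (V W : set T) (i : sieve_index s n) :
  W !=set0 -> W `<=` V -> V `<=` sieve_set i ->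
  lex_least le V i -> lex_least le W i.
Proof.
move=> [w Ww] WV; elim: n i => [|n IH] i Vi /=.
  move=> [_ imin]; split; first by exists w; split => //; exact/Vi/WV.
  by move=> j [x [jx Wx]]; apply: imin; exists x; split => //; exact: WV.
move=> [si [_ imin]]; split.
  by apply: IH => //; apply: subset_trans (@sieve_setS _ i).
split; first by exists w; split => //; exact/Vi/WV.
by move=> j ji [x [jx Wx]]; apply: imin => //; exists x; split => //; exact: WV.
Qed.

Definition lex_base n : set (set T) := [set V | [/\ open V, V !=set0 &
  exists2 i : sieve_index s n, lex_least le V i & V `<=` sieve_set i]].

(** Induction on the level: inside [O] take a member [V] of level [n] with index [i], then cut [V]
    with the set of the least child of [i] that meets it. *)
Lemma lex_base_pi_base n : open_sieve s -> pi_base (lex_base n).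
Proof.
move=> os; split=> [V []//|O oO O0].
elim: n => [|n [V [oV V0 [i Vi iV]] VO]].
  have [x [Ox [i _ ix]]] := sieve_almost_cover s 0 O0 oO.
  have [|k kO kmin] := @le_min 0%N [set j | sieve_set j `&` O !=set0].
    by exists i, x.
  exists (sieve_set k `&` O); last exact: subIsetr.
  split=> //; first exact: openI (os _ _) _.
  exists k; last exact: subIsetl.
  split; first by have [y [ky Oy]] := kO; exists y.
  by move=> j [y [jy [ky Oy]]]; apply: kmin; exists y.
(* Some child meets [V], since the children of [i] are dense in its set, which contains [V]. *)
have [y Vy] := V0; have [_ /(_ _ (iV _ Vy) V)] := sieve_dense i.
move=> [|z [[j ji jz] Vz]]; first exact: open_nbhs_nbhs.
have [|k [ki kV] kmin] := @le_min n.+1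
    [set j | sieve_proj j = i /\ sieve_set j `&` V !=set0].
  by exists j; split => //; exists z.
exists (sieve_set k `&` V); last by apply: subset_trans VO; exact: subIsetr.
split=> //; first exact: openI (os _ _) _.
exists k; last exact: subIsetl.
split; first by rewrite ki; apply: lex_leastS Vi => //; exact: subIsetr.
split; first by have [w [kw Vw]] := kV; exists w.
move=> l; rewrite ki => li [w [lw [kw Vw]]].
by apply: kmin; split => //; exists w.
Qed.

(** The index of [V n] and the projected index of [V n.+1] are both lexicographically least for
    [V n.+1], hence equal. *)
Lemma lex_base_chain (V : nat -> set T) :
  (forall n, lex_base n (V n) /\ V n.+1 `<=` V n) ->
  exists2 i : forall n, sieve_index s n,
    pi_chain i & forall n, V n `<=` sieve_set (i n).
Proof.
move=> VP.
have /dependent_fun_choice[i iP] : forall n, exists i : sieve_index s n,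
    lex_least le (V n) i /\ V n `<=` sieve_set i.
  by move=> n; have [[_ _ [i]]] := VP n; exists i.
exists i => [n|n]; last by case: (iP n).
have [Vi iV] := iP n; have [[Vi' _] _] := iP n.+1.
apply: lex_least_inj Vi' _; apply: lex_leastS Vi => //.
- by have [[]] := VP n.+1.
- by have [] := VP n.
Qed.

End lex_least.

Lemma almost_complete_pi_bases : almost_complete T ->
  exists2 P : nat -> set (set T), (forall n, pi_base (P n)) &
    forall V, (forall n, P n (V n) /\ closure (V n.+1) `<=` V n) ->
      complete_sequence V.
Proof.
move=> [s os cs].
have /dependent_fun_choice[le leP] := fun n => well_orderingP (sieve_index s n).
have le_anti n := (leP n).1; have le_min n := (leP n).2.
exists (lex_base le) => [n|V VP]; first exact: lex_base_pi_base.
have [|i ci Vi] := @lex_base_chain s le le_anti V.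
  move=> n; have [PV VS] := VP n; split=> // x Vx.
  by apply: VS; exact: subset_closure.
by apply: (complete_sequenceS Vi); exact: cs.
Qed.

Lemma almost_complete_pseudo_complete :
  almost_complete T -> pseudo_complete T.
Proof.
move=> /almost_complete_pi_bases[P Pb Pc]; exists P => // V VP.
apply: complete_sequence_bigcap; last exact: Pc.
- by move=> n; have [/(Pb n).1[]] := VP n.
- by move=> n; have [] := VP n.
Qed.

(** A nested sequence from the pi-bases is complete, so its intersection has a point, of which the
    members are open neighbourhoods. *)
Lemma almost_complete_q_point : @regular_space T -> [set: T] !=set0 ->
  almost_complete T -> exists x, q_point [set: T] x.
Proof.
move=> regT T0 /almost_complete_pi_bases[P Pb Pc].
have [|V [VP _]] := pi_base_nested regT (G := fun=> setT) T0 Pb.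
  by move=> n; split; [exact: openT|move=> O O0 _; rewrite setIT].
have VS n : closure (V n.+1) `<=` V n by have [] := VP n.
have [|x Vx] := complete_sequence_bigcap _ VS (Pc _ VP).
  by move=> n; have [/(Pb n).1[]] := VP n.
exists x; apply: complete_sequence_q_point (Pc _ VP); last exact: nested_subset.
by move=> n; split; [have [/(Pb n).1[]] := VP n|exact: Vx].
Qed.

End sieve.

(** * q-points in pseudo-complete sigma-spaces *)

Section sigma_space.
Context (T : topologicalType).

Definition closure_boundary (A : set T) : set T := closure A `\` (closure A)°.

(** Near any point at most one member [A] matters. Openness: remove the closed boundary of that [A].
    Density: an open set covered by boundaries would, near each of its points, lie in one
    [closure A], making that point interior. *)
Lemma discrete_boundary_open_dense (N : set (set T)) : discrete_family N ->
  open (~` \bigcup_(A in N) closure_boundary A) /\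
  dense (~` \bigcup_(A in N) closure_boundary A).
Proof.
have meet_closure (A Q : set T) x : open Q -> Q x -> closure A x ->
    A `&` Q !=set0.
  by move=> oQ Qx; apply; exact: open_nbhs_nbhs.
move=> dN; split.
  rewrite openE => x xN; have [Q [oQ Qx] QN] := dN x.
  have [[A [NA AQ]]|nA] := pselect (exists A, N A /\ A `&` Q !=set0).
  - have : open_nbhs x (Q `&` ~` closure_boundary A).
      split; last by split=> // xA; apply: xN; exists A.
      apply: openI => //; apply: closed_openC; apply: closedI.
        exact: closed_closure.
      exact/open_closedC/open_interior.
    move=> /open_nbhs_nbhs; apply: filterS => y [Qy yA] [A' NA' yA'].
    suff AA' : A = A' by apply: yA; rewrite AA'.
    by apply: QN => //; apply: meet_closure Qy yA'.1.
  - apply: filterS (open_nbhs_nbhs (conj oQ Qx)) => y Qy [A NA [Ay _]].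
    by apply: nA; exists A; split => //; exact: meet_closure Qy Ay.
move=> W [x Wx] oW; have [Q [oQ Qx] QN] := dN x.
have oWQ : open (W `&` Q) by exact: openI.
apply: contrapT => /forallNP Wbd.
have bd y : W y -> (\bigcup_(A in N) closure_boundary A) y.
  by move=> Wy; apply: contrapT => yN; apply: (Wbd y).
have [A NA [Ax nAx]] := bd _ Wx.
apply: nAx.
apply: filterS (open_nbhs_nbhs (conj oWQ (conj Wx Qx))) => y [Wy Qy].
have [A' NA' [Ay _]] := bd _ Wy.
rewrite (QN A A' NA NA') //; first exact: meet_closure Ax.
exact: meet_closure Qy Ay.
Qed.

Lemma discrete_family_nbhs (N : set (set T)) (x : T) : discrete_family N ->
  exists2 W, open_nbhs x W &
    forall A, N A -> (closure A)° x -> W `<=` closure A.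
Proof.
move=> dN.
have [[A [NA Ax]]|nA] := pselect (exists A, N A /\ (closure A)° x); last first.
  exists setT; first exact: open_nbhsT.
  by move=> A NA Ax; case: nA; exists A.
exists (closure A)°; first by split => //; exact: open_interior.
move=> A' NA' A'x; have [Q /open_nbhs_nbhs Qx QN] := dN x.
rewrite -(QN A A' NA NA'); first exact: interior_subset.
- exact: (interior_subset Ax) Qx.
- exact: (interior_subset A'x) Qx.
Qed.

Lemma first_countable_q_point (x : T) (W : nat -> set T) :
  (forall n, open_nbhs x (W n)) ->
  (forall Q, open_nbhs x Q -> exists n, W n `<=` Q) ->
  q_point [set: T] x.
Proof.
move=> Wx WQ.
pose U := fix U n := if n is m.+1 then U m `&` W m.+1 else W 0%N.
have UW n : U n `<=` W n by case: n => //= n y [].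
have US m n : (m <= n)%N -> U n `<=` U m.
  move=> /subnK <-; elim: (n - m)%N => [//|k IH]; rewrite addSn.
  by move=> y [/IH].
exists U => [|u uU]; first by elim=> //= n IH; exact: open_nbhsI.
exists x; rewrite clusterEonbhs => A Q [k _ kA] /WQ[n WnQ].
exists (u (maxn k n)); split; first by apply: kA => /=; exact: leq_maxl.
by apply/WnQ/UW/(US n (maxn k n) (leq_maxr _ _)); have [] := uU (maxn k n).
Qed.

(** A network member containing [x] has [x] in the interior of its closure once [x] avoids all
    boundaries. By discreteness one neighbourhood per level [D n] handles all such members, and
    these neighbourhoods form a countable base at [x]. *)
Lemma pseudo_complete_sigma_q_point : @regular_space T -> [set: T] !=set0 ->
  pseudo_complete T -> sigma_space T -> exists x, q_point [set: T] x.
Proof.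
move=> regT T0 pcT [N netN [D dD NE]].
have [x xG] := pseudo_complete_baire regT T0 pcT
  (fun n => discrete_boundary_open_dense (dD n)).
have /choice[W WP] : forall n, exists W, open_nbhs x W /\
    forall A, D n A -> (closure A)° x -> W `<=` closure A.
  by move=> n; have [W xW WA] := discrete_family_nbhs x (dD n); exists W.
exists x; apply: (first_countable_q_point (W := W)) => [n|Q xQ].
  by have [] := WP n.
have [Q' xQ' QQ'] := regular_open_nbhs regT xQ.
have [A [NA Ax AQ']] := netN _ _ xQ'.
move: NA; rewrite NE => -[n _ DA]; exists n.
apply: subset_trans (subset_trans (closureS AQ') QQ').
have [_] := WP n; apply => //.
apply: contrapT => nAx; apply: (xG n I).
by exists A => //; split => //; exact: subset_closure.
Qed.

End sigma_space.

(** * Sigma-discrete networks from a countable base of entourages *)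

Section countable_uniformity.
Context (T : uniformType).
Hypothesis cuT : countable_uniformity T.

(* A network need not consist of open sets, so the classes [H n m a] of points
   whose least covering index is [a] can be used as they are: they are
   [E m]-separated, and no Stone-type refinement is necessary. *)
Lemma countable_uniformity_sigma_space : sigma_space T.
Proof.
have [E Ebase entE] := countable_uniformityP.1 cuT.
have [le [le_anti le_min]] := well_orderingP T.
pose U n a : set T := (xsection (E n) a)°.
pose H n m a : set T := [set x | [/\ U n a x,
  (forall b, U n b x -> le a b) & xsection (E m) x `<=` U n a]].
pose D k : set (set T) := if unpickle k is Some (n, m) then range (H n m)
  else set0.
exists (\bigcup_k D k); last first.
  exists D => // k x; rewrite /D; case: unpickle => [[n m]|]; last first.
    by exists setT => //; exact: open_nbhsT.
  pose F := split_ent (E m) `&` (split_ent (E m))^-1%relation.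
  have entF : entourage F by exact/entourage_invI/entourage_split_ent.
  have nearF y z : xsection F x y -> xsection F x z -> xsection (E m) y z.
    move=> /xsectionP[_ yx] /xsectionP[xz _]; apply/xsectionP.
    exact: entourage_split yx xz.
  exists (xsection F x)°; first exact: open_nbhs_entourage.
  move=> _ _ [a _ <-] [b _ <-] [y [[ay amin ya] /interior_subset Fy]].
  move=> [z [[bz bmin zb] /interior_subset Fz]]; congr H; apply: le_anti.
  (* Being [E m]-close, [y] lies in [U n b] and [z] in [U n a], so each index is at most the
     other. *)
  - by apply: amin; apply: zb; exact: nearF.
  - by apply: bmin; apply: ya; exact: nearF.
move=> x Q /open_nbhs_nbhs; rewrite -nbhs_entourageE => -[G entG GQ].
pose F := split_ent G `&` (split_ent G)^-1%relation.
have entF : entourage F by exact/entourage_invI/entourage_split_ent.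
have [n EF] := Ebase _ entF.
have Uaa a : U n a a by have [] := open_nbhs_entourage a (entE n).
have [|a ax amin] := le_min [set a | U n a x]; first by exists x; exact: Uaa.
(* With [n] and the least index [a] fixed, [m] is taken large enough that the [E m]-section at [x]
   fits in [U n a]. *)
have : nbhs x (U n a).
  by apply: open_nbhs_nbhs; split=> //; exact: open_interior.
rewrite -nbhs_entourageE => -[F' /Ebase[m EF'] F'U].
exists (H n m a); split.
- exists (pickle (n, m)) => //; rewrite /D pickleK; by exists a.
- split=> //; apply: subset_trans F'U => y /xsectionP xy.
  by apply/xsectionP; exact: EF'.
- move=> y [/interior_subset/xsectionP/EF[ay _] _ _]; apply: GQ.
  have /interior_subset/xsectionP/EF[_ ya] := ax.
  by apply/xsectionP; exact: entourage_split ya ay.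
Qed.

End countable_uniformity.

(** * Almost sieves from pi-bases of small sets *)

Section countable_pseudo_complete.
Context (T : uniformType) (E : nat -> set (T * T)) (P : nat -> set (set T)).
Hypothesis Ebase : forall A, entourage A -> exists n, E n `<=` A.
Hypothesis entE : forall n, entourage (E n).
Hypothesis Pb : forall n, pi_base (P n).
Hypothesis Pnested : forall V,
  (forall n, P n (V n) /\ closure (V n.+1) `<=` V n) -> \bigcap_n V n !=set0.

(** Smallness makes every filterbase controlled by a chain cluster at any point common to the
    chain. *)
Let small n : set (set T) := [set V | P n V /\ V `*` V `<=` E n].

Let small_pi_base n : pi_base (small n).
Proof.
split=> [V [/(Pb n).1]//|Q oQ [x Qx]].
pose F := split_ent (E n) `&` (split_ent (E n))^-1%relation.
have entF : entourage F by exact/entourage_invI/entourage_split_ent.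
have [oW Wx] := open_nbhsI (conj oQ Qx) (open_nbhs_entourage x entF).
have [|V PV VQ] := (Pb n).2 _ oW; first by exists x.
exists V; last by move=> y /VQ[].
split=> // -[y z] /= [/VQ[_ /interior_subset/xsectionP[_ yx]]].
move=> /VQ[_ /interior_subset/xsectionP[xz _]].
exact: entourage_split yx xz.
Qed.

(* A level of the sieve is indexed by arbitrary lists of sets, latest set
   first; the lists that are not nested index the empty set. *)
Let nested := fix nested (n : nat) (s : seq (set T)) : Prop :=
  if s is V :: s' then
    small n V /\
    if n is m.+1 then closure V `<=` head set0 s' /\ nested m s' else True
  else False.

Let nested_head n s : nested n s -> small n (head set0 s).
Proof. by case: n s => [|n] [|V s]//= []. Qed.

Let sset n (s : seq (set T)) : set T := [set x | nested n s /\ head set0 s x].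

Let sset_dense n s : dense_subset
  (\bigcup_(t in behead @^-1` [set s]) sset n.+1 t) (sset n s).
Proof.
split=> [x [t]|x [ns sx] Q].
  case: t => [|V t] /= <- [] //= [_ [Vt nt]] Vx.
  by split=> //; apply: Vt; exact: subset_closure.
rewrite nbhsE => -[Q' [oQ' xQ'] Q'Q].
have [os _] := (small_pi_base n).1 _ (nested_head ns).
have [||V sV VsQ] := pi_base_closure uniform_regular (small_pi_base n.+1)
  (O := head set0 s `&` Q').
- exact: openI.
- by exists x.
- have [_ [y Vy]] := (small_pi_base n.+1).1 _ sV.
  exists y; split; last by apply/Q'Q; have [] := VsQ _ (subset_closure Vy).
  by exists (V :: s) => //; split=> //=; split=> //; split=> // z /VsQ[].
Qed.

Let sset_cover n : almost_cover (sset n).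
Proof.
move=> Q Q0 oQ; elim: n => [|n [x [Qx [s _ sx]]]].
  have [V sV VQ] := (small_pi_base 0).2 _ oQ Q0.
  have [_ [x Vx]] := (small_pi_base 0).1 _ sV.
  by exists x; split; [exact: VQ|exists [:: V]].
have [_ /(_ _ sx Q)] := sset_dense n s.
move=> [|y [[t _ ty] Qy]]; [exact: open_nbhs_nbhs|].
by exists y; split => //; exists t.
Qed.

Lemma nested_pi_base_almost_complete : almost_complete T.
Proof.
exists (AlmostSieve sset_cover sset_dense) => [n s|i ci F [F0 Fne FI] Fi] /=.
  have [ns|ns] := pselect (nested n s).
    have [os _] := (small_pi_base n).1 _ (nested_head ns).
    suff -> : sset n s = head set0 s by [].
    by apply/seteqP; split=> x // [].
  suff -> : sset n s = set0 by exact: open0.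
  by apply/seteqP; split=> x // [].
(* Control by nonempty sets excludes the junk lists, which index the empty set. *)
have ni n : nested n (i n).
  by have [A FA Ai] := Fi n; have [x /Ai[]] := Fne _ FA.
pose V n := head set0 (i n).
have [|x Vx] := Pnested (V := V).
  move=> n; split; first by have [] := nested_head (ni n).
  rewrite /V; have := ci n; have := ni n.+1.
  by case: (i n.+1) => //= W t [_ [Wt _]] <-.
exists x => A Q FA; rewrite -nbhs_entourageE => -[G /Ebase[n EG] GQ].
(* A member of [F] inside both [A] and the [n]-th set of the chain consists of points [E n]-close to
   [x]. *)
have [A' FA' A'i] := Fi n; have [C FC CAA'] := FI _ _ FA FA'.
have [y Cy] := Fne _ FC; exists y; split; first by have [] := CAA' _ Cy.
apply/GQ/xsectionP/EG; have [_ VE] := nested_head (ni n).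
apply: VE; split => /=; first exact: Vx.
by have [_ /A'i[]] := CAA' _ Cy.
Qed.

End countable_pseudo_complete.

Lemma pseudo_complete_almost_complete (T : uniformType) :
  countable_uniformity T -> pseudo_complete T -> almost_complete T.
Proof.
move=> /countable_uniformityP[E Ebase entE] [P Pb Pn].
exact: nested_pi_base_almost_complete Ebase entE Pb Pn.
Qed.

(** * q-points and countable bases for strong uniform convergence *)

Section strong_uniform_convergence.
Context (R : realType) (X : metricType R) (B : bornology X).
Local Notation C := (continuousType X R).

Lemma closure_enlargement (A : set X) (d : R) :
  0 < d -> closure A `<=` enlargement A d.
Proof.
move=> d0 x /(_ (ball x d))[|a [Aa]]; first exact: nbhsx_ballx.
by rewrite ballEmdist; exists a.
Qed.

(** Hence a bound on an enlargement of [A] also holds on the same enlargement of [closure A], which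
    lets closures of the [A n] suffice as a base. *)
Lemma enlargement_closure (A : set X) (d : R) :
  enlargement (closure A) d `<=` enlargement A d.
Proof.
move=> x [a Aa /= ax]; rewrite -subr_gt0 in ax.
have [b Ab /= ba] := closure_enlargement ax Aa.
exists b => //=; apply: le_lt_trans (metric_triangle _ a _) _.
by rewrite -ltrBrDl.
Qed.

Lemma not_closure_mdist (A : set X) (x : X) : ~ closure A x ->
  exists2 r : R, 0 < r & forall a, A a -> r <= mdist x a.
Proof.
move=> /existsNP[U /not_implyP[/nbhs_ballP[r /= r0 rU] AU]].
exists r => // a Aa; rewrite leNgt; apply/negP => xa; apply: AU.
by exists a; split => //; apply: rU; rewrite ballEmdist.
Qed.

Lemma continuous_bump (f : C) (x : X) (r c : R) : 0 < r ->
  exists g : C, g x = f x + c /\ forall y, r <= mdist x y -> g y = f y.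
Proof.
move=> r0.
(* [f] plus a tent of height [c] over the ball of radius [r] at [x]. *)
pose g (y : X) : R := f y + c * Num.max 0 (1 - mdist x y / r).
have mc : continuous (fun y : X => mdist x y : R).
  move=> y; apply/cvgrPdist_lt => e e0; near=> z.
  have yz : mdist y z < e.
    near: z; have := nbhsx_ballx y _ e0; by rewrite ballEmdist.
  rewrite ltr_distl; apply/andP; split.
    rewrite ltrBlDr; apply: le_lt_trans (metric_triangle _ y _) _.
    by rewrite ltrD2l.
  by apply: le_lt_trans (metric_triangle _ z _) _; rewrite ltrD2l metric_sym.
have gc : continuous g.
  move=> y; apply: cvgD; first exact: cts_fun.
  apply: cvgM; first exact: cvg_cst.
  apply: (@continuous_max _ _ (cst 0) (fun y => 1 - mdist x y / r)).
    exact: cvg_cst.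
  apply: cvgB; first exact: cvg_cst.
  by apply: cvgM; [exact: mc|exact: cvg_cst].
exists (mkcts gc); split=> [|y ry]; rewrite /= /mkcts /g /=.
  by rewrite mdistxx mul0r subr0 (max_idPr ler01) mulr1.
by rewrite (max_idPl _) ?mulr0 ?addr0// subr_le0 ler_pdivlMr ?mul1r.
Unshelve. all: by end_near. Qed.

Lemma bornology_set1 (x : X) : bornology_set B [set x].
Proof.
have : [set: X] x by [].
rewrite -(bornology_cover B) => -[A BA Ax].
by apply: (bornologyS BA) => [_ ->//|]; exists x.
Qed.

Lemma strong_entourageP (A : set X) (e : R) : bornology_set B A -> 0 < e ->
  entourage (strong_entourage A e : set (strongC B * strongC B)).
Proof. by move=> BA e0; exists (A, e). Qed.

Section q_point_bornology.
Variables (D : set (strongC B)) (f : strongC B) (U : nat -> set (strongC B)).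
Hypothesis dD : dense D.
Hypothesis fU : forall n, open_nbhs f (U n).
Hypothesis qU : forall u : nat -> strongC B,
  (forall n, (U n `&` D) (u n)) -> cluster (u @ \oo) !=set0.
Variable A : nat -> set X.
Hypothesis BA : forall n, bornology_set B (A n).
Hypothesis Am : forall m n, (m <= n)%N -> A m `<=` A n.
Hypothesis AU : forall n, exists2 e, 0 < e & forall g : strongC B,
  @strong_entourage R X (A n) e (f, g) -> U n g.

(** Each [g n] is an element of [D] approximating [f] plus a bump of height [n] at [x n]; [h] is a
    cluster point of these. *)
Lemma q_point_escape (x : nat -> X) : (forall n, ~ closure (A n) (x n)) ->
  exists (g : nat -> C) (h : C),
  [/\ forall n y, closure (A n) y -> `|g n y - (f : C) y| < 1,
      forall n, (f : C) (x n) + n%:R - 1 < g n (x n) &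
      forall E, bornology_set B E -> forall N, exists2 n, (N <= n)%N &
        forall y, E y -> `|h y - g n y| < 1].
Proof.
move=> xA.
have /choice[g gP] : forall n, exists g : C, [/\ (U n `&` D) (g : strongC B),
    forall y, closure (A n) y -> `|g y - (f : C) y| < 1 &
    (f : C) (x n) + n%:R - 1 < g (x n)].
  move=> n; have [r r0 rA] := not_closure_mdist (xA n).
  (* Halving [r] makes the bump vanish on the whole [r / 2]-enlargement of [A n], as strong
     closeness to [f] requires. *)
  have r20 : 0 < r / 2 by rewrite divr_gt0.
  have [k [kx kf]] := continuous_bump f (x n) n%:R r20.
  have kfA y : enlargement (A n) (r / 2) y -> k y = (f : C) y.
    move=> [a Aa /= ay]; apply: kf; rewrite leNgt; apply/negP => xy.
    have := rA _ Aa; rewrite leNgt => /negP; apply.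
    apply: le_lt_trans (metric_triangle _ y _) _.
    by rewrite (splitr r) ltrD.
  have Uk : U n (k : strongC B).
    have [e e0] := AU n; apply; exists (r / 2) => // y /kfA /= ->.
    by rewrite subrr normr0.
  (* Adding the point [x n] lets the approximation from [D] keep the height of the bump as well as
     the values on [A n]. *)
  have entk : entourage (strong_entourage (A n `|` [set x n]) 1 :
      set (strongC B * strongC B)).
    apply: strong_entourageP => //.
    by apply: bornologyU => //; exact: bornology_set1.
  have [oW Wk] := open_nbhsI (conj (fU n).1 Uk)
    (open_nbhs_entourage (k : strongC B) entk).
  have [|g [[Ug /interior_subset/xsectionP[d d0 kg]] Dg]] := dD _ oW.
    by exists (k : strongC B).
  exists g; split=> //.
    move=> y Ay; rewrite -(kfA y); last exact: closure_enlargement.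
    rewrite distrC; apply: kg.
    by have [a Aa ay] := closure_enlargement d0 Ay; exists a => //; left.
  have /kg /= : enlargement (A n `|` [set x n]) d (x n).
    by exists (x n); [right|rewrite /= mdistxx].
  by rewrite kx ltr_distlC => /andP[].
have [|h hP] := qU (u := g); first by move=> n; have [] := gP n.
exists g, h; split=> [n|n|E BE N]; [by have [] := gP n|by have [] := gP n|].
have [||_ [[n /= Nn <-] /xsectionP[d d0 hg]]] :=
    hP [set (g n : strongC B) | n in [set n | (N <= n)%N]]
       (xsection (strong_entourage E 1) h).
- by exists N => // n /= Nn; exists n.
- exact/nbhs_entourage/strong_entourageP.
- by exists n => // y Ey; apply: hg; exists y => //=; rewrite mdistxx.
Qed.

Lemma q_point_closure_cover (y : X) : exists n, closure (A n) y.
Proof.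
apply: contrapT => /forallNP yA.
(* Here the bumps all sit at [y]. Closeness of [h] to [g n] at [y] gives n < h y - f y + 2, which
   fails for large [n]. *)
have [g [h [_ gx /(_ _ (bornology_set1 y))hg]]] := q_point_escape yA.
have [n] := hg (Num.bound `|h y - (f : C) y + 2|).
move=> Nn /(_ _ erefl); rewrite ltr_distlC => /andP[_ gh].
have := lt_trans (gx n) gh; apply/negP; rewrite -leNgt.
have : h y - (f : C) y + 2 <= n%:R.
  apply: le_trans (real_ler_norm (num_real _)) _.
  apply: le_trans (ltW (archi_boundP (normr_ge0 _))) _.
  by rewrite ler_nat.
lra.
Qed.

Lemma q_point_closure_base (E : set X) : bornology_set B E ->
  exists n, E `<=` closure (A n).
Proof.
move=> BE; apply: contrapT => /forallNP EA.
have /choice[x xP] : forall n, exists x, E x /\ ~ closure (A n) x.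
  by move=> n; have /existsNP[x /not_implyP] := EA n; exists x.
have [g [h [gf gx hg]]] := q_point_escape (fun n => (xP n).2).
(* From n >= 4, h (x n) > f (x n) + n - 2 >= f (x n) + 2. But [x n] lies in [closure (A m)] for all
   large [m], and one such [g m] is within 1 of both [f] and [h] there. *)
have [n n4 /(_ (x n) (xP n).1)] := hg _ BE 4.
rewrite ltr_distlC => /andP[_ gh].
have [N xN] := q_point_closure_cover (x n).
have [m Nm /(_ _ erefl)] := hg _ (bornology_set1 (x n)) N.
have /gf : closure (A m) (x n) by apply: closureS xN; exact: Am.
have : (4 : R) <= n%:R by rewrite (ler_nat _ 4).
rewrite !ltr_distlC => n4R /andP[fg _] /andP[hgm _].
have := gx n; lra.
Qed.

End q_point_bornology.

Lemma q_point_countable_uniformity (D : set (strongC B)) (f : strongC B) :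
  dense D -> q_point D f -> countable_uniformity (strongC B).
Proof.
move=> dD [U fU qU].
have /choice[A0 A0P] : forall n, exists A, bornology_set B A /\
    exists2 e, 0 < e & forall g : strongC B,
      @strong_entourage R X A e (f, g) -> U n g.
  move=> n; have := open_nbhs_nbhs (fU n).
  rewrite -nbhs_entourageE => -[E [[A e] [/= BA e0] AE] EU].
  by exists A; split => //; exists e => // g /AE/xsectionP; exact: EU.
(* Finite unions make the sequence increasing without leaving the bornology. *)
pose A := fix A n := if n is m.+1 then A m `|` A0 m.+1 else A0 0%N.
have BA n : bornology_set B (A n).
  elim: n => [|n IH]; first exact: (A0P 0%N).1.
  by apply: bornologyU => //; exact: (A0P _).1.
have Am m n : (m <= n)%N -> A m `<=` A n.
  move=> /subnK <-; elim: (n - m)%N => [//|k IH]; rewrite addSn.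
  by move=> x /IH; left.
have A0A n : A0 n `<=` A n by case: n => // n x; right.
have AU n : exists2 e, 0 < e & forall g : strongC B,
    @strong_entourage R X (A n) e (f, g) -> U n g.
  have [_ [e e0 eU]] := A0P n; exists e => // g [d d0 fg]; apply: eU.
  by exists d => // y [a /A0A Aa ay]; apply: fg; exists a.
apply/countable_uniformityP.
pose F k : set (strongC B * strongC B) :=
  if unpickle k is Some (n, m) then @strong_entourage R X (A n) m.+1%:R^-1
  else setT.
exists F => [G [[E e] [/= BE e0] EG]|k].
  have [n En] := q_point_closure_base dD fU qU BA Am AU BE.
  have [m me] : exists m, m.+1%:R^-1 < e.
    exists (Num.bound e^-1); rewrite invf_plt ?posrE//.
    apply: lt_le_trans (archi_boundP _) _; first by rewrite invr_ge0 ltW.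
    by rewrite ler_nat.
  exists (pickle (n, m)); rewrite /F pickleK => -[u v] [d d0 uv]; apply: EG.
  exists d => // y [a Ea ay]; apply: lt_trans me; apply: uv.
  by apply: enlargement_closure; exists a => //; exact: En.
rewrite /F; case: unpickle => [[n m]|]; last exact: filterT.
by apply: strong_entourageP => //; rewrite invr_gt0.
Qed.

End strong_uniform_convergence.

Theorem theorem4p7 (R : realType) (X : metricType R) (B : bornology X)
    (S : set (set X)) (hS : closed_base B S) :
  [<-> almost_complete (strongC B);
       pseudo_complete (strongC B) /\ sigma_space (strongC B);
       pseudo_complete (strongC B) /\
         exists D : set (strongC B), dense D /\ exists f, q_point D f].
Proof.
have regC : @regular_space (strongC B) by exact: uniform_regular.
have C0 : [set: strongC B] !=set0.
  by exists (cst 0 : continuousType X R).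
have dT : dense [set: strongC B] by move=> Q Q0 _; rewrite setIT.
tfae.
- move=> acC; split; first exact: almost_complete_pseudo_complete.
  (* The whole space serves as the dense set [D]. *)
  have [f qf] := almost_complete_q_point regC C0 acC.
  exact/countable_uniformity_sigma_space/(q_point_countable_uniformity dT qf).
- move=> [pC sC]; split=> //; exists setT; split=> //.
  exact: pseudo_complete_sigma_q_point.
- move=> [pC [D [dD [f qf]]]]; apply: pseudo_complete_almost_complete pC.
  exact: q_point_countable_uniformity dD qf.
Qed.
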